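(* Let $B:\mathbb{R}^n\to\mathbb{R}$ be a control Barrier function for the system $\dot x=f(x)+g(x)u$ with input set $\mathcal{U}=\{u\in\mathbb{R}^m: Au+b\le 0\}$, with associated sets $\mathcal{B}=\{x\in\mathbb{R}^n: B(x)\ge 0\}\subseteq\mathcal{C}\subset\mathbb{R}^n$. Let $u^{\mathrm{des}}(x)\in\mathcal{U}$ be a given nominal controller and $p_s>0$. Then for every extended class-$\mathcal{K}$ function $\alpha$ and every $x\in\mathcal{C}$, writing $F(x)=-\mathcal{L}_fB(x)$, $G(x)=-\mathcal{L}_gB(x)$, $\Lambda(x)=-\alpha(B(x))$, the optimisation problem $$\min_{s\in\mathbb{R},\,u\in\mathbb{R}^m}\ \tfrac{p_s}{2}(s-1)^2+\tfrac12\|u-u^{\mathrm{des}}(x)\|_2^2\quad\text{subject to}\quad F(x)+G(x)u+s\Lambda(x)\le 0,\qquad Au+b\le 0$$ is feasible.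
   Context: The system is $\dot x=f(x)+g(x)u$ with $x\in\mathbb{R}^n$, $u\in\mathcal{U}\subset\mathbb{R}^m$, where $f:\mathbb{R}^n\to\mathbb{R}^n$ and $g:\mathbb{R}^n\to\mathbb{R}^{n\times m}$ are Lipschitz continuous. The input set is $\mathcal{U}=\{u\in\mathbb{R}^m: Au+b\le 0\}$ (componentwise inequality) with $A\in\mathbb{R}^{p\times m}$, $b\in\mathbb{R}^p$; it is nonempty since it contains $u^{\mathrm{des}}(x)$. An extended class-$\mathcal{K}$ function is a continuous, strictly increasing function $\alpha:(-c,d)\to(-\infty,+\infty)$ with $c,d>0$ and $\alpha(0)=0$ (its domain is understood to contain the values $B(x)$, $x\in\mathcal{C}$). Lie derivatives: $\mathcal{L}_fB(x)=\frac{\partial B(x)}{\partial x}f(x)\in\mathbb{R}$ and $\mathcal{L}_gB(x)=\frac{\partial B(x)}{\partial x}g(x)\in\mathbb{R}^{1\times m}$. A continuously differentiable $B:\mathbb{R}^n\to\mathbb{R}$ is a control Barrier function for the set $\mathcal{B}$ if there exist some extended class-$\mathcal{K}$ function $\alpha_0$ and a set $\mathcal{C}$ with $\mathcal{B}\subseteq\mathcal{C}\subset\mathbb{R}^n$ such that for every $x\in\mathcal{C}$, $\sup_{u\in\mathcal{U}}[\mathcal{L}_fB(x)+\mathcal{L}_gB(x)u+\alpha_0(B(x))]\ge 0$. Here $\mathcal{B}$ is the zero-super level set of $B$. The function $\alpha$ in the optimisation problem need not equal $\alpha_0$. Feasible means that there exists a pair $(s,u)\in\mathbb{R}\times\mathbb{R}^m$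 satisfying both constraints. *)

(* Defs.v *)
From HB Require Import structures.
From mathcomp Require Import all_boot all_order all_algebra.
From mathcomp Require Import all_classical all_reals all_analysis.

Set Implicit Arguments.
Unset Strict Implicit.
Unset Printing Implicit Defensive.

Import Order.TTheory GRing.Theory Num.Theory.
Import numFieldNormedType.Exports.

Local Open Scope classical_set_scope.
Local Open Scope ring_scope.

(* Points of R^n are column vectors; the derivative dB/dx of a scalar function
   is a row vector.  The topology of 'cV[R]_n and of 'M[R]_(n, m) is that of the
   library's sup norm, which induces the usual notions of continuity and of
   Lipschitz continuity. *)

Definition gradient (R : realType) (n : nat) (B : 'cV[R]_n -> R)
    (x : 'cV[R]_n) : 'rV[R]_n :=
  \row_(i < n) 'D_(delta_mx i 0) B x.

Definition continuously_differentiable (R : realType) (n : nat)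
    (B : 'cV[R]_n -> R) : Prop :=
  (forall x, differentiable B x) /\ continuous (gradient B).

(* The 1 x 1 matrix (dB/dx) f(x) is identified with its entry. *)
Definition lie_f (R : realType) (n : nat) (f : 'cV[R]_n -> 'cV[R]_n)
    (B : 'cV[R]_n -> R) (x : 'cV[R]_n) : R :=
  (gradient B x *m f x) 0 0.

Definition lie_g (R : realType) (n m : nat) (g : 'cV[R]_n -> 'M[R]_(n, m))
    (B : 'cV[R]_n -> R) (x : 'cV[R]_n) : 'rV[R]_m :=
  gradient B x *m g x.

Definition input_set (R : realType) (m p : nat) (A : 'M[R]_(p, m))
    (b : 'cV[R]_p) : set 'cV[R]_m :=
  [set u | forall i : 'I_p, (A *m u + b) i 0 <= 0].

Definition zero_superlevel (R : realType) (n : nat) (B : 'cV[R]_n -> R) :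
    set 'cV[R]_n :=
  [set x | 0 <= B x].

(* The open interval (-c, d); the endpoints may be infinite. *)
Definition class_K_dom (R : realType) (c d : \bar R) : set R :=
  [set y | (- c < y%:E)%E /\ (y%:E < d)%E].

(* A function (-c, d) -> R is represented by a total function, of which only
   the values on (-c, d) matter. *)
Definition extended_class_K (R : realType) (c d : \bar R) (alpha : R -> R) :
    Prop :=
  [/\ (0 < c)%E /\ (0 < d)%E,
      {within class_K_dom c d, continuous alpha},
      (forall y z, class_K_dom c d y -> class_K_dom c d z ->
         y < z -> alpha y < alpha z)
    & alpha 0 = 0].

(* The supremum is taken in the extended reals: it is +oo when the values are
   unbounded above (and -oo when U is empty). *)
Definition control_barrier_function (R : realType) (n m : nat)
    (f : 'cV[R]_n -> 'cV[R]_n) (g : 'cV[R]_n -> 'M[R]_(n, m))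
    (U : set 'cV[R]_m) (B : 'cV[R]_n -> R) (C : set 'cV[R]_n) : Prop :=
  [/\ continuously_differentiable B,
      zero_superlevel B `<=` C
    & exists (c d : \bar R) (alpha0 : R -> R),
      [/\ extended_class_K c d alpha0,
          (forall x, C x -> class_K_dom c d (B x))
        & forall x, C x ->
          (0 <= ereal_sup [set (lie_f f B x + (lie_g g B x *m u) 0 0
                                + alpha0 (B x))%:E | u in U])%E]].

Definition norm2 (R : realType) (m : nat) (v : 'cV[R]_m) : R :=
  Num.sqrt (\sum_(i < m) v i 0 ^+ 2).

Record min_problem (R : realType) (V : Type) := MinProblem {
  objective : V -> R;
  constraints : set V
}.

Definition feasible (R : realType) (V : Type) (P : min_problem R V) : Prop :=
  constraints P !=set0.

(* The decision variable is the pair v = (s, u). *)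
Definition cbf_qp (R : realType) (n m p : nat)
    (f : 'cV[R]_n -> 'cV[R]_n) (g : 'cV[R]_n -> 'M[R]_(n, m))
    (A : 'M[R]_(p, m)) (b : 'cV[R]_p) (B : 'cV[R]_n -> R) (alpha : R -> R)
    (udes : 'cV[R]_n -> 'cV[R]_m) (ps : R) (x : 'cV[R]_n) :
    min_problem R (R * 'cV[R]_m) :=
  let F := - lie_f f B x in
  let G := - lie_g g B x in
  let Lambda := - alpha (B x) in
  MinProblem
    (fun v => ps / 2 * (v.1 - 1) ^+ 2 + 1 / 2 * norm2 (v.2 - udes x) ^+ 2)
    [set v | F + (G *m v.2) 0 0 + v.1 * Lambda <= 0 /\ input_set A b v.2].

(* Main.v *)
Require Import Defs.
From HB Require Import structures.
From mathcomp Require Import all_boot all_order all_algebra.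
From mathcomp Require Import all_classical all_reals all_analysis.
From mathcomp Require Import lra.

Set Implicit Arguments.
Unset Strict Implicit.
Unset Printing Implicit Defensive.

Import Order.TTheory GRing.Theory Num.Theory.
Import numFieldNormedType.Exports.

Local Open Scope classical_set_scope.
Local Open Scope ring_scope.

(** If B(x) <> 0, then alpha(B(x)) <> 0 and the slack s, which is free in sign,
    makes the barrier constraint hold for any admissible input, in particular
    for the nominal one.

    If B(x) = 0, then alpha(B(x)) = alpha0(B(x)) = 0: the slack has no effect,
    and an admissible u with L_f B(x) + L_g B(x) u >= 0 is needed.  The barrier
    condition only bounds a supremum from below, so the point is that the
    supremum of an affine function over a polyhedron, which may be unbounded, is
    attained when it is finite.  This follows from Fourier-Motzkin elimination
    [fourier_motzkin]: for a fixed matrix A, the solvability in u of A u + y <= 0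
    is itself a finite system of homogeneous linear inequalities M y <= 0 on the
    right-hand side y.  Such a system passes to the limit, so a system of
    inequalities that is solvable up to every e > 0 is solvable
    [limit_solvable]. *)

(** Eliminating one variable: a lower and an upper bound on z, coming from
    coefficients of opposite signs, are compatible exactly when the positive
    combination of the two inequalities that cancels z holds.  The pairs (i, j)
    that do not give such a combination are assigned row i when z does not occur
    in it, and the trivial row otherwise. *)
Lemma eliminate_variable (R : realFieldType) (p : nat) (a : 'cV[R]_p) :
  exists (q : nat) (N : 'M[R]_(q, p)), forall y : 'cV[R]_p,
    (exists z : R, forall i, a i 0 * z + y i 0 <= 0) <->
    (forall k, (N *m y) k 0 <= 0).
Proof.
pose w (ij : 'I_p * 'I_p) : 'rV[R]_p :=
  if a ij.1 0 == 0 then delta_mx 0 ij.1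
  else if (0 < a ij.1 0) && (a ij.2 0 < 0)
    then a ij.1 0 *: delta_mx 0 ij.2 - a ij.2 0 *: delta_mx 0 ij.1
  else 0.
exists #|{: 'I_p * 'I_p}|, (\matrix_k w (enum_val k)) => y.
have NyE k : ((\matrix_k w (enum_val k)) *m y) k 0 = (w (enum_val k) *m y) 0 0.
  by rewrite -[in RHS](rowK (fun k => w (enum_val k))) -row_mul [RHS]mxE.
have deltaE i : (delta_mx 0 i *m y : 'M[R]_1) 0 0 = y i 0 by rewrite -rowE mxE.
have combE s t i j :
    ((s *: delta_mx 0 j - t *: delta_mx 0 i) *m y : 'M[R]_1) 0 0
    = s * y j 0 - t * y i 0.
  by rewrite mulmxBl -!scalemxAl -!rowE !mxE.
split=> [[z az] k|Ny].
  rewrite NyE /w; case: (enum_val k) => i j /=.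
  case: eqP => [a0|_].
    by rewrite deltaE; have := az i; rewrite a0 mul0r add0r.
  case: ifP => [/andP[ai aj]|_]; last by rewrite mul0mx mxE.
  rewrite combE.
  have := az i; have := az j; nra.
have wy i j : (w (i, j) *m y) 0 0 <= 0.
  by have := Ny (enum_rank (i, j)); rewrite NyE enum_rankK.
have y0 i : a i 0 = 0 -> y i 0 <= 0.
  by move=> a0; have := wy i i; rewrite /w /= a0 eqxx deltaE.
have ypair i j : 0 < a i 0 -> a j 0 < 0 -> a i 0 * y j 0 - a j 0 * y i 0 <= 0.
  move=> ai aj; have := wy i j.
  by rewrite /w /= gt_eqF// ai aj /= combE.
have [[j0 aj0]|noneg] := pselect (exists j, a j 0 < 0).
  (* The greatest lower bound is a solution. *)
  case: (@Order.TotalTheory.arg_maxP _ _ _ j0 (fun j => a j 0 < 0)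
    (fun j => - y j 0 / a j 0) aj0) => j aj maxj.
  exists (- y j 0 / a j 0) => i.
  have [ai|ai|ai] := ltgtP (a i 0) 0.
  - by have /= := maxj i ai; rewrite ler_ndivrMr//; lra.
  - have aj' : a j 0 * (- y j 0 / a j 0) = - y j 0.
      by rewrite mulrC divfK// lt_eqF.
    have := ypair i j ai aj; nra.
  - by rewrite ai mul0r add0r; exact: y0.
(* Without lower bounds, any sufficiently negative z is a solution. *)
exists (- \sum_i `|y i 0 / a i 0|) => i.
have [ai|ai|ai] := ltgtP (a i 0) 0.
- by case: noneg; exists i.
- have : `|y i 0 / a i 0| <= \sum_i `|y i 0 / a i 0|.
    by rewrite (bigD1 i)//= lerDl sumr_ge0.
  move/(le_trans (ler_norm _)); rewrite ler_pdivrMr//; lra.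
- by rewrite ai mul0r add0r; exact: y0.
Qed.

(** Eliminating the first variable acts linearly on all inequalities at once, so
    it replaces the right-hand side y by N y; the matrices of the successive
    eliminations therefore multiply, independently of y. *)
Lemma fourier_motzkin (R : realFieldType) (p m : nat) (A : 'M[R]_(p, m)) :
  exists (q : nat) (M : 'M[R]_(q, p)), forall y : 'cV[R]_p,
    (exists u : 'cV[R]_m, forall i, (A *m u + y) i 0 <= 0) <->
    (forall k, (M *m y) k 0 <= 0).
Proof.
elim: m p A => [|m IHm] p A.
  exists p, 1%:M => y; rewrite mul1mx; split=> [[u]|y0].
    by rewrite [u]flatmx0 mulmx0 add0r.
  by exists 0; rewrite mulmx0 add0r.
pose a : 'cV[R]_p := lsubmx (A : 'M[R]_(p, 1 + m)).
pose A' : 'M[R]_(p, m) := rsubmx (A : 'M[R]_(p, 1 + m)).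
have [q [N HN]] := eliminate_variable a.
have [r [M HM]] := IHm q (N *m A').
(* A u + y splits into the contribution of the first variable z and that of the
   remaining ones. *)
have AE (z : R) (u : 'cV[R]_m) (y : 'cV[R]_p) i :
    (A *m (col_mx z%:M u : 'cV[R]_(1 + m)) + y) i 0
    = a i 0 * z + (A' *m u + y) i 0.
  have -> : A *m (col_mx z%:M u : 'cV[R]_(1 + m)) = a *m z%:M + A' *m u.
    by rewrite -mul_row_col hsubmxK.
  rewrite mul_mx_scalar -addrA.
  by rewrite mxE [X in X + _]mxE mulrC.
exists r, (M *m N) => y; rewrite -mulmxA -HM; split=> [[u Au]|[u]].
  exists (dsubmx (u : 'cV[R]_(1 + m))); rewrite -mulmxA -mulmxDr; apply/HN.
  exists (usubmx (u : 'cV[R]_(1 + m)) 0 0) => i.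
  by rewrite -AE -mx11_scalar vsubmxK.
rewrite -mulmxA -mulmxDr => /HN[z zu].
by exists (col_mx z%:M u : 'cV[R]_(1 + m)) => i; rewrite AE.
Qed.

(** No compactness is available, as the approximate solutions may escape to
    infinity when e goes to 0; the inequalities given by elimination bear on the
    right-hand side only, and those are affine in e. *)
Lemma limit_solvable (R : realFieldType) (p m : nat) (A : 'M[R]_(p, m))
    (y v : 'cV[R]_p) :
  (forall e, 0 < e -> exists u : 'cV[R]_m,
    forall i, (A *m u + (y - e *: v)) i 0 <= 0) ->
  exists u : 'cV[R]_m, forall i, (A *m u + y) i 0 <= 0.
Proof.
have [q [M HM]] := fourier_motzkin A => approx.
apply/HM => k; rewrite leNgt; apply/negP => My.
set c := (M *m y) k 0 in My.
(* This e is so small that e * (M v)_k < (M y)_k. *)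
pose e := c / (`|(M *m v) k 0| + 1).
have v1 : 0 < `|(M *m v) k 0| + 1 by rewrite ltr_wpDl.
have e0 : 0 < e by rewrite divr_gt0.
have /HM/(_ k) := approx e e0.
rewrite mulmxBr -scalemxAr mxE [X in _ + X]mxE [X in _ - X]mxE -/c.
have : e * (`|(M *m v) k 0| + 1) = c by rewrite divfK// gt_eqF.
have := ler_norm ((M *m v) k 0); nra.
Qed.

(** A nonnegative supremum of an affine function over a polyhedron is either
    exceeded or attained. *)
Lemma affine_sup_ge0_attained (R : realType) (m p : nat) (A : 'M[R]_(p, m))
    (b : 'cV[R]_p) (r : 'rV[R]_m) (k : R) :
  (0 <= ereal_sup [set (k + (r *m u) 0 0)%:E | u in input_set A b])%E ->
  exists2 u, input_set A b u & 0 <= k + (r *m u) 0 0.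
Proof.
move=> sup0.
(* The requirement k + r u >= - e is appended to the system as a last row. *)
have blockE (u : 'cV[R]_m) (e : R) :
    col_mx A (- r) *m u + (col_mx b (- k)%:M - e *: col_mx 0 1%:M)
    = col_mx (A *m u + b) (- (k + (r *m u) 0 0 + e))%:M.
  rewrite mul_col_mx scale_col_mx opp_col_mx !add_col_mx scaler0 subr0.
  congr col_mx; apply/matrixP => i j.
  rewrite !ord1 mulNmx !mxE eqxx !mulr1n; lra.
have [e e0|u Hu] :=
    @limit_solvable R _ _ (col_mx A (- r)) (col_mx b (- k)%:M) (col_mx 0 1%:M).
  have /ereal_sup_gt[_ [u Uu <-]] : ((- e)%:E <
      ereal_sup [set (k + (r *m u) 0 0)%:E | u in input_set A b])%E.
    by apply: lt_le_trans sup0; rewrite lte_fin oppr_lt0.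
  rewrite lte_fin => ue; exists u => i; rewrite blockE mxE.
  case: splitP => j _; first exact: Uu.
  by rewrite ord1 mxE eqxx mulr1n; lra.
have {}Hu i :
    (col_mx (A *m u + b) (- (k + (r *m u) 0 0))%:M : 'cV[R]_(p + 1)) i 0 <= 0.
  have := Hu i.
  by rewrite -[X in _ + X]subr0 -[X in _ - X](scale0r (col_mx 0 1%:M)) blockE addr0.
exists u => [i|]; first by have := Hu (lshift 1 i); rewrite col_mxEu.
by have := Hu (rshift p 0); rewrite col_mxEd mxE eqxx mulr1n oppr_le0.
Qed.

(** Strict monotonicity makes 0 the only zero of alpha on its domain. *)
Lemma class_K_neq0 (R : realType) (c d : \bar R) (alpha : R -> R) (y : R) :
  extended_class_K c d alpha -> class_K_dom c d y -> y != 0 -> alpha y != 0.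
Proof.
move=> [[c0 d0] _ mono alpha0] dy.
have d00 : class_K_dom c d 0 by split=> //; rewrite oppe_lt0.
case: (ltgtP y 0) => // y0 _.
- by have := mono _ _ dy d00 y0; rewrite alpha0 => /lt_eqF ->.
- by have := mono _ _ d00 dy y0; rewrite alpha0 => /gt_eqF ->.
Qed.

Theorem theorem3 (R : realType) (n m p : nat)
    (f : 'cV[R]_n -> 'cV[R]_n) (g : 'cV[R]_n -> 'M[R]_(n, m))
    (lip_f : lipschitz f) (lip_g : lipschitz g)
    (A : 'M[R]_(p, m)) (b : 'cV[R]_p)
    (B : 'cV[R]_n -> R) (C : set 'cV[R]_n)
    (cbf_B : control_barrier_function f g (input_set A b) B C)
    (udes : 'cV[R]_n -> 'cV[R]_m)
    (udesU : forall x, input_set A b (udes x))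
    (ps : R) (ps_gt0 : 0 < ps)
    (c d : \bar R) (alpha : R -> R)
    (alphaK : extended_class_K c d alpha)
    (alpha_dom : forall x, C x -> class_K_dom c d (B x))
    (x : 'cV[R]_n) (Cx : C x) :
  feasible (cbf_qp f g A b B alpha udes ps x).
Proof.
suff [s [u Uu su]] : exists s, exists2 u, input_set A b u &
    0 <= lie_f f B x + (lie_g g B x *m u) 0 0 + s * alpha (B x).
  exists (s, u); split=> //=; rewrite mulNmx mxE; lra.
have [Bx0|Bx0] := eqVneq (B x) 0.
  case: cbf_B => _ _ [c0 [d0 [alpha0 [[_ _ _ alpha00] _ /(_ x Cx)]]]].
  rewrite Bx0 alpha00; under eq_imagel do rewrite addr0.
  move=> /affine_sup_ge0_attained[u Uu ku].
  by exists 0, u => //; rewrite mul0r addr0.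
have alphax := class_K_neq0 alphaK (alpha_dom _ Cx) Bx0.
(* This s turns the barrier constraint into an equality. *)
exists (- (lie_f f B x + (lie_g g B x *m udes x) 0 0) / alpha (B x)), (udes x).
  exact: udesU.
by rewrite divfK// subrr.
Qed.
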